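(* Let $x^\circ$ be a feasible solution for $\mathcal{IP}$. For any $B\in\mathcal{B}$, if $x^\circ$ is an optimal solution for $\mathcal{G}^B$ then $x^\circ$ is an optimal solution for $\mathcal{IP}$. Consequently, $$\mathit{IFR}(\mathcal{LP},x^\circ)\subseteq\bigcup_{B\in\mathcal{B}}\mathit{IFR}(\mathcal{G}^B,x^\circ)\subseteq\mathit{IFR}(\mathcal{IP},x^\circ).$$ Additionally, $$z(\mathit{Inv}(\mathcal{LP},x^\circ))\ \ge\ \min_{B\in\mathcal{B}}z(\mathit{Inv}(\mathcal{G}^B,x^\circ))\ \ge\ z(\mathit{Inv}(\mathcal{IP},x^\circ)).$$
   Context: Let $m\le n$, let $A\in\mathbb{Z}^{m\times n}$ have full row rank, and let $b\in\mathbb{Z}^m$, $c\in\mathbb{R}^n$. The integer program $\mathcal{IP}$ is $\min\{c^\intercal x\mid Ax=b,\ x\ge\mathbf{0},\ x\in\mathbb{Z}^n\}$, assumed to have nonempty feasible region; its LP relaxation $\mathcal{LP}$ is $\min\{c^\intercal x\mid Ax=b,\ x\ge\mathbf{0},\ x\in\mathbb{R}^n\}$. A basis is a set $B\subseteq\{1,\dots,n\}$ with $|B|=m$ such that the submatrix $A_B$ of columns indexed by $B$ is nonsingular; $N=\{1,\dots,n\}\setminus B$, $A_N$ is the submatrix of columns indexed by $N$, and for a vector $v\in\mathbb{R}^n$, $v_B,v_N$ are its subvectors indexed by $B,N$. The basis $B$ is feasible for $\mathcal{LP}$ if $A_B^{-1}b\ge\mathbf{0}$. $\mathcal{B}$ denotes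 the finite set of all feasible bases of $\mathcal{LP}$. The Gomory corner relaxation $\mathcal{G}^B$ of $\mathcal{IP}$ with respect to $B$ is $\min\{c_B^\intercal x_B+c_N^\intercal x_N\mid A_Bx_B+A_Nx_N=b,\ x_N\ge\mathbf{0},\ x\in\mathbb{Z}^n\}$ (the nonnegativity of $x_B$ is dropped). For $d\in\mathbb{R}^n$ and $\mathcal{P}\in\{\mathcal{IP},\mathcal{LP},\mathcal{G}^B\}$, $\mathcal{P}^d$ is the problem $\mathcal{P}$ with objective vector $c$ replaced by $d$. For a feasible solution $x^\circ$ of $\mathcal{P}$, the inverse-feasible region $\mathit{IFR}(\mathcal{P},x^\circ)$ is the set of all $d\in\mathbb{R}^n$ such that $x^\circ$ is an optimal solution for $\mathcal{P}^d$. The inverse problem $\mathit{Inv}(\mathcal{P},x^\circ)$ has optimal value $z(\mathit{Inv}(\mathcal{P},x^\circ)):=\min\{\lVert d-c\rVert_p\mid d\in\mathit{IFR}(\mathcal{P},x^\circ)\}$, where $\lVert\cdot\rVert_p$ is a fixed (possibly weighted) $L_p$ norm on $\mathbb{R}^n$, the same in all the inverse problems. *)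

(* Defs.v *)
From mathcomp Require Import all_boot all_order all_algebra.
From mathcomp Require Import all_classical all_reals all_analysis.

Set Implicit Arguments.
Unset Strict Implicit.
Unset Printing Implicit Defensive.

Import Order.TTheory GRing.Theory Num.Theory.

Local Open Scope classical_set_scope.
Local Open Scope ring_scope.

(** Vectors of R^n and Z^n are column vectors over [R]; integrality of vectors
    and matrices is membership in [mxOver Num.int]. *)

Definition nonneg (R : realType) (n : nat) (x : 'cV[R]_n) : bool :=
  [forall j, 0 <= x j 0].

(** The columns of [A] indexed by an [m]-subset [B] are listed in increasing
    order, so that [A_B] is a square matrix. *)
Definition basis_col (m n : nat) (B : {B : {set 'I_n} | #|B| == m}) (i : 'I_m) :
  'I_n := enum_val (cast_ord (esym (eqP (valP B))) i).

Definition basis_mx (R : realType) (m n : nat) (A : 'M[R]_(m, n))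
  (B : {B : {set 'I_n} | #|B| == m}) : 'M[R]_m := colsub (basis_col B) A.

Definition feasible_basis (R : realType) (m n : nat) (A : 'M[R]_(m, n))
  (b : 'cV[R]_m) (B : {B : {set 'I_n} | #|B| == m}) : bool :=
  (basis_mx A B \in unitmx) && nonneg (invmx (basis_mx A B) *m b).

(** A minimization problem with a replaceable linear objective is represented by
    its feasible region. *)

Definition LP (R : realType) (m n : nat) (A : 'M[R]_(m, n)) (b : 'cV[R]_m) :
  set 'cV[R]_n := [set x | A *m x = b /\ nonneg x].

Definition IP (R : realType) (m n : nat) (A : 'M[R]_(m, n)) (b : 'cV[R]_m) :
  set 'cV[R]_n := [set x | [/\ A *m x = b, nonneg x & x \is a mxOver Num.int]].

(** [A *m x = b] is [A_B x_B + A_N x_N = b], and likewise the objective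
    [d^T x] is [d_B^T x_B + d_N^T x_N]. *)
Definition corner (R : realType) (m n : nat) (A : 'M[R]_(m, n)) (b : 'cV[R]_m)
  (B : {B : {set 'I_n} | #|B| == m}) : set 'cV[R]_n :=
  [set x | [/\ A *m x = b, forall j, j \notin val B -> 0 <= x j 0
             & x \is a mxOver Num.int]].

Definition dot (R : realType) (n : nat) (d x : 'cV[R]_n) : R :=
  (d^T *m x) 0 0.

Definition optimal (R : realType) (n : nat) (P : set 'cV[R]_n)
  (d x : 'cV[R]_n) : Prop :=
  P x /\ forall y, P y -> dot d x <= dot d y.

Definition IFR (R : realType) (n : nat) (P : set 'cV[R]_n) (x : 'cV[R]_n) :
  set 'cV[R]_n := [set d | optimal P d x].

(** Weighted L_p norm for [1 <= p <= +oo] and positive weights; the value at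
    [-oo] is irrelevant. For finite [p], weights [w'] placed outside the power,
    (\sum_j w'_j |v_j|^p)^(1/p), correspond to [w = w' `^ p^-1]. *)
Definition wLp (R : realType) (n : nat) (p : \bar R) (w v : 'cV[R]_n) : R :=
  match p with
  | EFin q => (\sum_j (w j 0 * `|v j 0|) `^ q) `^ q^-1
  | +oo%E => \big[Num.max/0]_j (w j 0 * `|v j 0|)
  | -oo%E => 0
  end.

Definition inv_values (R : realType) (n : nat) (p : \bar R) (w c : 'cV[R]_n)
  (P : set 'cV[R]_n) (x : 'cV[R]_n) : set \bar R :=
  [set (wLp p w (d - c))%:E | d in IFR P x].

(** The infimum is a minimum exactly when it belongs to [inv_values]. *)
Definition zInv (R : realType) (n : nat) (p : \bar R) (w c : 'cV[R]_n)
  (P : set 'cV[R]_n) (x : 'cV[R]_n) : \bar R :=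
  ereal_inf (inv_values p w c P x).

(* Main.v *)
Require Import Defs.
From mathcomp Require Import all_boot all_order all_algebra.
From mathcomp Require Import all_classical all_reals all_analysis.

Set Implicit Arguments.
Unset Strict Implicit.
Unset Printing Implicit Defensive.

Import Order.TTheory GRing.Theory Num.Theory.
Import numFieldNormedType.Exports.

Local Open Scope classical_set_scope.
Local Open Scope ring_scope.

(** Dropping the constraints [x_B >= 0] enlarges the feasible region of the
    integer program, so a point of [IP A b] that is optimal for a corner
    relaxation is optimal for the integer program ([IP_sub_corner], [IFR_sub]).

    The inclusion of [IFR (LP A b) x0] in the union over the feasible bases
    amounts to the existence of an optimal basis in the strong sense: if [d] has
    an optimal solution [x] over [LP A b], then some feasible basis [B] also has
    nonnegative reduced costs [d^T - y A], where [y = d_B^T A_B^-1]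
    ([LP_optimal_basis]). Given such a [B], every feasible point [z] of the
    corner relaxation satisfies [d^T z >= y A z = y b], because the reduced
    costs vanish on [B] and [z_N >= 0]. Moreover [y b] is the cost of the basic
    solution of [B], which is LP-feasible, hence [y b >= d^T x]. So [x] is
    optimal for the corner relaxation when it is integral
    ([LP_optimal_corner]).

    At a degenerate vertex an optimal solution does not determine such a basis.
    The right-hand side [b = A x] is therefore perturbed to [A (x + u)] with
    [u = (e, e^2, ..., e^n)]. For all small [e > 0] the perturbed right-hand
    side is not a combination of fewer than [m] columns of [A]
    ([near0_nondegenerate]), because a row vector annihilating such columns
    takes on it the value of a nonzero polynomial in [e]. A Caratheodory
    argument yields an optimal solution of the perturbed program whose support
    indexes independent columns ([optimal_vertex]); nondegeneracy makes this
    support a basis, and a negative reduced cost would give an improving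
    feasible direction ([nondegenerate_optimal_basis]). Reduced costs do not
    depend on the right-hand side, and a basis that is feasible for arbitrarily
    small [e] is feasible for [b] ([near0_feasible_basis]).

    The optimal values of the inverse problems are attained because each
    inverse-feasible region is closed and contains [0], while the norm is
    continuous and dominates every weighted coordinate, so that the minimum may
    be taken over a compact set ([inv_value_attained]). The inequalities between
    the optimal values then follow from the inclusions. *)

(** * Vertices and bases of linear programs *)

Section LinearProgramming.
Variable R : realType.

Lemma dotE n (d x : 'cV[R]_n) : dot d x = \sum_j d j 0 * x j 0.
Proof. by rewrite /dot mxE; apply: eq_bigr => j _; rewrite mxE. Qed.

Lemma dotDr n (d x y : 'cV[R]_n) : dot d (x + y) = dot d x + dot d y.
Proof. by rewrite /dot mulmxDr mxE. Qed.

Lemma dotNr n (d x : 'cV[R]_n) : dot d (- x) = - dot d x.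
Proof. by rewrite /dot mulmxN mxE. Qed.

Lemma dotZr n (d x : 'cV[R]_n) t : dot d (t *: x) = t * dot d x.
Proof. by rewrite /dot -scalemxAr mxE. Qed.

Lemma nonnegP n (x : 'cV[R]_n) : reflect (forall j, 0 <= x j 0) (nonneg x).
Proof. exact: forallP. Qed.

(** The support of a vector, as a finite set of indices. *)
Definition supp n (x : 'cV[R]_n) : {set 'I_n} := [set j | x j 0 != 0]%SET.

(** The columns of [A] indexed by [S] are linearly independent; a linear
    relation between them is a vector of the kernel of [A] supported in [S]. *)
Definition indep m n (A : 'M[R]_(m, n)) (S : {set 'I_n}) : Prop :=
  forall h : 'cV[R]_n, supp h \subset S -> A *m h = 0 -> h = 0.

Lemma suppPn n (x : 'cV[R]_n) j : reflect (x j 0 = 0) (j \notin supp x).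
Proof. by rewrite inE negbK; exact: eqP. Qed.

Lemma supp_subP n (x : 'cV[R]_n) (S : {set 'I_n}) :
  reflect (forall j, j \notin S -> x j 0 = 0) (supp x \subset S).
Proof.
apply: (iffP fintype.subsetP) => [sub j jS|z j].
  by apply/suppPn; apply: contra jS; exact: sub.
by rewrite inE; apply: contra_neqT; exact: z.
Qed.

(** The ratio test: along [h], the largest step that keeps [x] nonnegative
    makes one more coordinate vanish. *)
Lemma drop_support m n (A : 'M[R]_(m, n)) (x h : 'cV[R]_n) :
  nonneg x -> supp h \subset supp x -> (exists j, h j 0 < 0) ->
  exists t, [/\ 0 <= t, nonneg (x + t *: h)
              & supp (x + t *: h) \proper supp x].
Proof.
move=> /nonnegP x0 /supp_subP hx [j0 hj0].
pose F j := x j 0 / - h j 0.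
have [j hj jmin] :=
  @Order.TotalTheory.arg_minP _ _ _ j0 (fun j => h j 0 < 0) F hj0.
have t0 : 0 <= F j by rewrite divr_ge0// oppr_ge0 ltW.
have eqj : x j 0 + F j * h j 0 = 0.
  by rewrite /F invrN mulrN mulNr divfK ?subrr// lt_eqF.
exists (F j); split=> //.
  apply/nonnegP => k; rewrite !mxE.
  have [hk|hk] := ltP (h k 0) 0; last by rewrite addr_ge0// mulr_ge0.
  have := jmin k hk; rewrite {2}/F ler_pdivlMr ?oppr_gt0//.
  by rewrite mulrN -subr_ge0 opprK.
apply/properP; split.
  apply/supp_subP => k /suppPn xk.
  by rewrite !mxE xk hx ?inE ?xk ?eqxx// mulr0 addr0.
exists j; last by apply/suppPn; rewrite !mxE.
by apply/negPn/negP => /hx hj'; rewrite hj' ltxx in hj.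
Qed.

(** Reduction to an independent support without increasing the cost. The
    hypothesis on [d] says that the cost is nonnegative on the recession cone;
    it excludes unbounded descent along a kernel vector. *)
Lemma caratheodory m n (A : 'M[R]_(m, n)) (d x : 'cV[R]_n) :
  (forall h, nonneg h -> A *m h = 0 -> 0 <= dot d h) -> nonneg x ->
  exists x', [/\ A *m x' = A *m x, nonneg x', dot d x' <= dot d x
               & indep A (supp x')].
Proof.
move=> rec; have [k] := ubnP #|supp x|; elim: k x => // k IH x xk x0.
have [|nindep] := pselect (indep A (supp x)); first by exists x.
have [h [hx Ah hd hneg]] : exists h, [/\ supp h \subset supp x, A *m h = 0,
    dot d h <= 0 & exists j, h j 0 < 0].
  have [h [hx Ah h0]] :
      exists h, [/\ supp h \subset supp x, A *m h = 0 & h <> 0].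
    apply: contrapT => H; apply: nindep => h hx Ah.
    by apply: contrapT => h0; apply: H; exists h.
  (* Either [h] or [- h] has nonpositive cost; a nonnegative vector of
     nonpositive cost has cost 0, and then its opposite may be used. *)
  have suppN : supp (- h) = supp h.
    by apply/setP => j; rewrite !inE mxE oppr_eq0.
  have negP (g : 'cV[R]_n) : ~~ nonneg g -> exists j, g j 0 < 0.
    by rewrite negb_forall => /existsP[j]; rewrite -ltNge; exists j.
  have [h1|] := boolP (nonneg h).
    have [h2|h2] := boolP (nonneg (- h)); last first.
      exists (- h); rewrite suppN mulmxN Ah oppr0 dotNr oppr_le0; split=> //.
        exact: rec.
      exact: negP.
    case: h0; apply/matrixP => i j; rewrite ord1 mxE; apply/eqP.
    rewrite eq_le (nonnegP _ h1) andbT.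
    by move/nonnegP: h2 => /(_ i); rewrite mxE oppr_ge0.
  move=> /negP h1; have [h2|/ltW h2] := leP (dot d h) 0; first by exists h.
  have [h3|/negP h3] := boolP (nonneg (- h)); last first.
    by exists (- h); rewrite suppN mulmxN Ah oppr0 dotNr oppr_le0; split.
  have := rec _ h3; rewrite mulmxN Ah oppr0 dotNr oppr_ge0 => /(_ erefl) h4.
  by exists h.
have [t [t0 xt st]] := drop_support A x0 hx hneg.
have [||x' [Ax' x'0 dx' ix']] := IH (x + t *: h) => //.
  by rewrite (leq_trans (proper_card st)).
exists x'; split=> //.
  by rewrite Ax' mulmxDr -scalemxAr Ah scaler0 addr0.
by rewrite (le_trans dx')// dotDr dotZr gerDl mulr_ge0_le0.
Qed.

(** The optimum is attained since only finitely many supports are possible and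
    a feasible point with independent support is determined by its support. *)
Lemma optimal_vertex m n (A : 'M[R]_(m, n)) (d x : 'cV[R]_n) :
  (forall h, nonneg h -> A *m h = 0 -> 0 <= dot d h) -> nonneg x ->
  exists v, [/\ A *m v = A *m x, nonneg v, indep A (supp v)
    & forall z, A *m z = A *m x -> nonneg z -> dot d v <= dot d z].
Proof.
move=> rec x0.
pose Q (S : {set 'I_n}) v := [/\ A *m v = A *m x, nonneg v & supp v = S].
pose f S := xget 0 (Q S).
pose P (S : {set 'I_n}) := `[< indep A S /\ exists v, Q S v >].
have [x1 [Ax1 x10 _ ix1]] := caratheodory rec x0.
have P1 : P (supp x1) by apply/asboolP; split=> //; exists x1.
have [S PS Smin] :=
  @Order.TotalTheory.arg_minP _ _ _ _ P (fun S => dot d (f S)) P1.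
move/asboolP: PS => [iS [v0 Qv0]].
have [Af f0 sf] : Q S (f S) by exact: (xgetPex 0 (ex_intro _ v0 Qv0)).
exists (f S); rewrite sf; split=> // z Az z0.
have [z1 [Az1 z10 dz1 iz1]] := caratheodory rec z0.
rewrite Az in Az1; apply: le_trans dz1.
have Qz1 : Q (supp z1) z1 by [].
have /Smin : P (supp z1) by apply/asboolP; split=> //; exists z1.
suff -> : f (supp z1) = z1 by [].
have [Ag g0 sg] : Q (supp z1) (f (supp z1)).
  exact: (xgetPex 0 (ex_intro _ z1 Qz1)).
apply/eqP; rewrite -subr_eq0; apply/eqP/iz1.
  apply/supp_subP => j jz; rewrite !mxE (suppPn _ _ jz).
  by rewrite -sg in jz; rewrite (suppPn _ _ jz) subr0.
by rewrite mulmxBr Ag Az1 subrr.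
Qed.

(** The vector of [R^n] with coordinates [u] at the positions listed by [f] and
    zero elsewhere ([f] is meant to be injective). *)
Definition pad k n (f : 'I_k -> 'I_n) (u : 'cV[R]_k) : 'cV[R]_n :=
  colsub f 1%:M *m u.

Lemma mul_pad m n k (A : 'M[R]_(m, n)) (f : 'I_k -> 'I_n) u :
  A *m pad f u = colsub f A *m u.
Proof. by rewrite /pad mulmxA mulmx_colsub mulmx1. Qed.

Lemma dot_pad n k (d : 'cV[R]_n) (f : 'I_k -> 'I_n) u :
  dot d (pad f u) = dot (rowsub f d) u.
Proof.
rewrite /dot mul_pad; congr ((_ *m _) _ _).
by apply/matrixP => i j; rewrite !mxE.
Qed.

Lemma pad_in k n (f : 'I_k -> 'I_n) u i : injective f ->
  pad f u (f i) 0 = u i 0.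
Proof.
move=> finj; rewrite mxE (bigD1 i)//= !mxE eqxx mul1r big1 ?addr0// => j ji.
by rewrite !mxE (inj_eq finj) eq_sym (negbTE ji) mul0r.
Qed.

Lemma pad_out k n (f : 'I_k -> 'I_n) u j : (forall i, f i != j) ->
  pad f u j 0 = 0.
Proof.
move=> fj; rewrite mxE big1// => i _.
by rewrite !mxE eq_sym (negbTE (fj i)) mul0r.
Qed.

(** Independent columns form a matrix of full column rank, stated as full row
    rank of the transpose. *)
Lemma indep_row_free m n k (A : 'M[R]_(m, n)) (S : {set 'I_n})
    (f : 'I_k -> 'I_n) :
  indep A S -> injective f -> (forall i, f i \in S) -> row_free (colsub f A)^T.
Proof.
move=> iS finj fS; apply: inj_row_free => u u0.
have p0 : pad f u^T = 0.
  apply: iS.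
    apply/supp_subP => j jS; apply: pad_out => i.
    by apply: contraNneq jS => <-.
  by rewrite mul_pad; apply: trmx_inj; rewrite trmx_mul trmxK u0 trmx0.
by apply/rowP => i; have := pad_in u^T i finj; rewrite p0 !mxE => <-.
Qed.

Lemma indep_card m n (A : 'M[R]_(m, n)) S : indep A S -> (#|S| <= m)%N.
Proof.
move=> iS; have := indep_row_free iS (@enum_val_inj _ _) (fun i => enum_valP i).
by rewrite /row_free => /eqP <-; rewrite mxrank_tr rank_leq_row.
Qed.

Section Basis.
Variables (m n : nat) (B : {B : {set 'I_n} | #|B| == m}).

Lemma basis_col_inj : injective (basis_col B).
Proof. by move=> i j /enum_val_inj/cast_ord_inj. Qed.

Lemma basis_col_in i : basis_col B i \in val B.
Proof. exact: enum_valP. Qed.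

Lemma basis_colP j : j \in val B -> exists i, j = basis_col B i.
Proof.
move=> jB; exists (cast_ord (eqP (valP B)) (enum_rank_in jB j)).
by rewrite /basis_col cast_ordK enum_rankK_in.
Qed.

Lemma basis_colPn j : j \notin val B -> forall i, basis_col B i != j.
Proof. by move=> jB i; apply: contraNneq jB => <-; exact: basis_col_in. Qed.

End Basis.

Lemma feasible_step n (x g : 'cV[R]_n) :
  nonneg x -> (forall k, k \notin supp x -> 0 <= g k 0) ->
  exists2 t, 0 < t & nonneg (x + t *: g).
Proof.
move=> /nonnegP x0 xg.
pose t := \big[Num.min/1]_(k | g k 0 < 0) (x k 0 / - g k 0).
exists t.
  rewrite lt_bigmin//= => k gk; rewrite divr_gt0 ?oppr_gt0//.
  rewrite lt_neqAle x0 andbT eq_sym; apply: contraTneq gk => xk.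
  by rewrite -leNgt xg// inE xk eqxx.
apply/nonnegP => k; rewrite !mxE; have [gk|gk] := ltP (g k 0) 0.
  have : t <= x k 0 / - g k 0 by exact: bigmin_le_cond.
  by rewrite ler_pdivlMr ?oppr_gt0// mulrN -subr_ge0 opprK.
rewrite addr_ge0// mulr_ge0// le_bigmin// => i gi.
by rewrite divr_ge0// oppr_ge0 ltW.
Qed.

(** The reduced costs [d^T - d_B^T A_B^-1 A] are nonnegative. *)
Definition dual_feasible m n (A : 'M[R]_(m, n)) (d : 'cV[R]_n)
  (B : {B : {set 'I_n} | #|B| == m}) : Prop :=
  forall j, ((rowsub (basis_col B) d)^T *m invmx (basis_mx A B) *m A) 0 j
            <= d j 0.

(** If every solution of the equality constraints has at least [m] nonzero
    coordinates, then an optimal vertex is positive on a whole basis, so that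
    each nonbasic variable can be increased from it. *)
Lemma nondegenerate_optimal_basis m n (A : 'M[R]_(m, n)) (d x : 'cV[R]_n) :
  (forall h, nonneg h -> A *m h = 0 -> 0 <= dot d h) -> nonneg x ->
  (forall z, A *m z = A *m x -> (m <= #|supp z|)%N) ->
  exists B, feasible_basis A (A *m x) B /\ dual_feasible A d B.
Proof.
move=> rec x0 nondeg.
have [v [Av v0 iv vmin]] := optimal_vertex rec x0.
have cv : #|supp v| == m by rewrite eqn_leq (indep_card iv) nondeg.
pose B : {B : {set 'I_n} | #|B| == m} := exist _ (supp v) cv.
have Bunit : basis_mx A B \in unitmx.
  rewrite -unitmx_tr -row_free_unit.
  exact: (indep_row_free iv (@basis_col_inj _ _ B) (basis_col_in B)).
have vE : v = pad (basis_col B) (rowsub (basis_col B) v).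
  apply/matrixP => j k; rewrite ord1.
  have [/basis_colP[i ->]|jB] := boolP (j \in val B).
    by rewrite pad_in ?mxE//; exact: basis_col_inj.
  by rewrite pad_out ?(suppPn _ _ jB)//; exact: basis_colPn.
exists B; split.
  rewrite /feasible_basis Bunit/= -Av vE mul_pad mulKmx//.
  by apply/nonnegP => i; rewrite mxE; exact: (nonnegP _ v0).
move=> j; rewrite leNgt; apply/negP => rj.
(* The edge direction that increases the nonbasic variable [j]; its cost is
   the reduced cost of [j]. *)
pose g := delta_mx j 0 -
  pad (basis_col B) (invmx (basis_mx A B) *m A *m delta_mx j 0).
have Ag : A *m g = 0.
  by rewrite mulmxBr mul_pad !mulmxA (mulmxV Bunit) mul1mx subrr.
have dg : dot d g < 0.
  rewrite dotDr dotNr dot_pad subr_lt0 /dot !mulmxA -!colE.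
  by rewrite !mxE; move: rj; rewrite !mxE.
have [t t0 vt] : exists2 t, 0 < t & nonneg (v + t *: g).
  apply: feasible_step => // k kv.
  rewrite mxE [X in _ + X]mxE pad_out; last exact: basis_colPn.
  by rewrite mxE subr0 ler0n.
have := vmin (v + t *: g).
rewrite mulmxDr -scalemxAr Ag scaler0 addr0 => /(_ Av vt).
by rewrite dotDr dotZr lerDl leNgt nmulr_llt0// t0.
Qed.

End LinearProgramming.

(** * Perturbation of the right-hand side *)

Section Perturbation.
Variable R : realType.

Lemma near0_right_root_free (p : {poly R}) :
  p != 0 -> \forall e \near 0^'+, p.[e] != 0.
Proof.
move=> p0; have [k [q]] := multiplicity_XsubC p 0; rewrite p0/= => q0 ->.
have qc : q.[e] @[e --> (0 : R)^'+] --> q.[0].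
  exact/cvg_at_right_filter/continuous_horner.
near=> e; rewrite hornerM mulf_neq0//; last first.
  by rewrite subr0 hornerXn expf_neq0// gt_eqF//; near: e; exact: nbhs_right_gt.
near: e; apply: (cvgr_neq0 _ qc); by [].
Unshelve. all: by end_near. Qed.

Lemma near0_right_horner_lt0 (p : {poly R}) :
  p.[0] < 0 -> \forall e \near 0^'+, p.[e] < 0.
Proof.
move=> p0; have pc : p.[e] @[e --> (0 : R)^'+] --> p.[0].
  exact/cvg_at_right_filter/continuous_horner.
exact: (cvgr_lt _ pc).
Qed.

(** The perturbation [(e, e^2, ..., e^n)]. *)
Definition eps_powers n (e : R) : 'cV[R]_n := \col_j e ^+ j.+1.

(** The value of [y] on the perturbed right-hand side [A (x + eps_powers n e)],
    as a polynomial in [e]. *)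
Definition perturbed_row m n (A : 'M[R]_(m, n)) (x : 'cV[R]_n)
  (y : 'rV[R]_m) : {poly R} :=
  ((y *m A *m x) 0 0)%:P + \sum_j (y *m A) 0 j *: 'X^(j.+1).

Lemma horner_perturbed_row m n (A : 'M[R]_(m, n)) x (y : 'rV[R]_m) e :
  (perturbed_row A x y).[e] = (y *m (A *m (x + eps_powers n e))) 0 0.
Proof.
rewrite hornerD hornerC horner_sum mulmxA mulmxDr [RHS]mxE; congr (_ + _).
rewrite [RHS]mxE; apply: eq_bigr => j _.
by rewrite hornerZ hornerXn [eps_powers _ _ _ _]mxE.
Qed.

Lemma horner0_perturbed_row m n (A : 'M[R]_(m, n)) x (y : 'rV[R]_m) :
  (perturbed_row A x y).[0] = (y *m A *m x) 0 0.
Proof.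
rewrite horner_perturbed_row mulmxA mulmxDr [LHS]mxE.
rewrite [X in _ + X]mxE big1 ?addr0// => j _.
by rewrite [eps_powers _ _ _ _]mxE expr0n mulr0.
Qed.

Lemma perturbed_row_neq0 m n (A : 'M[R]_(m, n)) x (y : 'rV[R]_m) :
  row_free A -> y != 0 -> perturbed_row A x y != 0.
Proof.
move=> Afree; apply: contra_neq => p0; apply: (row_free_inj Afree).
rewrite mul0mx; apply/rowP => j; rewrite [RHS]mxE.
have := congr1 (fun p : {poly R} => p`_j.+1) p0.
rewrite coef0 coefD coefC/= add0r coef_sum (bigD1 j)//= big1 ?addr0.
  by rewrite coefZ coefXn eqxx mulr1.
move=> i ij; rewrite coefZ coefXn eqSS eq_sym (inj_eq val_inj) (negbTE ij).
by rewrite mulr0.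
Qed.

Lemma annihilating_row m n (A : 'M[R]_(m, n)) (S : {set 'I_n}) :
  (#|S| < m)%N ->
  exists2 y : 'rV[R]_m, y != 0 &
    forall z, supp z \subset S -> y *m (A *m z) = 0.
Proof.
move=> Sm; pose M := colsub (fun i : 'I_#|S| => enum_val i) A.
have : kermx M != 0.
  rewrite -mxrank_eq0 mxrank_ker -lt0n subn_gt0.
  by rewrite (leq_ltn_trans (rank_leq_col _)).
move=> /rowV0Pn[y /sub_kermxP yM y0]; exists y => // z /supp_subP zS.
rewrite mulmxA; apply/matrixP => i k; rewrite !ord1 [RHS]mxE [LHS]mxE.
rewrite big1// => j _.
have [jS|/zS ->] := boolP (j \in S); last by rewrite mulr0.
have := congr1 (fun v : 'rV_ _ => v 0 (enum_rank_in jS j)) yM.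
rewrite mulmx_colsub mxE enum_rankK_in// [RHS]mxE => ->.
by rewrite mul0r.
Qed.

Lemma near0_nondegenerate m n (A : 'M[R]_(m, n)) x : row_free A ->
  \forall e \near 0^'+, forall z,
    A *m z = A *m (x + eps_powers n e) -> (m <= #|supp z|)%N.
Proof.
move=> Afree.
have : \forall e \near (0 : R)^'+, forall S : {set 'I_n}, (#|S| < m)%N ->
    forall z, A *m z = A *m (x + eps_powers n e) -> ~~ (supp z \subset S).
  apply: filter_forall => S; have [Sm|mS] := ltnP #|S| m; last by near=> e.
  have [y y0 yS] := annihilating_row A Sm.
  have := near0_right_root_free (perturbed_row_neq0 x Afree y0).
  apply: filterS => e pe _ z Az; apply: contra_neqN pe => /yS yz.
  by rewrite horner_perturbed_row -Az yz mxE.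
apply: filterS => e H z Az; rewrite leqNgt; apply/negP => zm.
by have := H _ zm _ Az; rewrite subxx.
Unshelve. all: by end_near. Qed.

(** Each coordinate of the basic solution is a polynomial in [e], negative for
    small [e] if it is negative at [0]. *)
Lemma near0_feasible_basis m n (A : 'M[R]_(m, n)) x :
  \forall e \near 0^'+, forall B : {B : {set 'I_n} | #|B| == m},
    feasible_basis A (A *m (x + eps_powers n e)) B ->
    feasible_basis A (A *m x) B.
Proof.
have : \forall e \near (0 : R)^'+, forall B : {B : {set 'I_n} | #|B| == m},
   forall i : 'I_m, (invmx (basis_mx A B) *m (A *m x)) i 0 < 0 ->
   (invmx (basis_mx A B) *m (A *m (x + eps_powers n e))) i 0 < 0.
  apply: filter_forall => B; apply: filter_forall => i.
  have [lt0|ge0] := ltP ((invmx (basis_mx A B) *m (A *m x)) i 0) 0; last first.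
    by near=> e.
  have rowE (v : 'cV[R]_m) :
    (row i (invmx (basis_mx A B)) *m v) 0 0 = (invmx (basis_mx A B) *m v) i 0.
    by rewrite -row_mul mxE.
  have := @near0_right_horner_lt0
    (perturbed_row A x (row i (invmx (basis_mx A B)))).
  rewrite horner0_perturbed_row -mulmxA rowE => /(_ lt0).
  by apply: filterS => e; rewrite horner_perturbed_row rowE.
apply: filterS => e H B /andP[uB /nonnegP fB]; apply/andP; split=> //.
apply/nonnegP => i; rewrite leNgt; apply/negP => /H.
by rewrite ltNge fB.
Unshelve. all: by end_near. Qed.

(** An optimal solution of a linear program with full row rank gives a basis
    that is both primal and dual feasible. *)
Lemma LP_optimal_basis m n (A : 'M[R]_(m, n)) b d x :
  \rank A = m -> optimal (LP A b) d x ->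
  exists B, feasible_basis A b B /\ dual_feasible A d B.
Proof.
move=> rA [[Ax x0] xopt]; have Afree : row_free A by apply/eqP.
have rec h : nonneg h -> A *m h = 0 -> 0 <= dot d h.
  move=> /nonnegP h0 Ah; rewrite -(lerDl (dot d x)) -dotDr; apply: xopt; split.
    by rewrite mulmxDr Ax Ah addr0.
  by apply/nonnegP => j; rewrite mxE addr_ge0 ?h0//; exact: (nonnegP _ x0).
have [e [e0 nondeg feas]] : exists e : R, [/\ 0 < e,
    forall z, A *m z = A *m (x + eps_powers n e) -> (m <= #|supp z|)%N
  & forall B : {B : {set 'I_n} | #|B| == m},
     feasible_basis A (A *m (x + eps_powers n e)) B ->
     feasible_basis A (A *m x) B].
  apply: (@filter_ex _ (0 : R)^'+); near=> e; split; near: e.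
  - exact: nbhs_right_gt.
  - exact: near0_nondegenerate.
  - exact: near0_feasible_basis.
have xe0 : nonneg (x + eps_powers n e).
  apply/nonnegP => j; rewrite !mxE addr_ge0 ?(nonnegP _ x0)//.
  by rewrite exprn_ge0// ltW.
have [B [/feas fB dB]] := nondegenerate_optimal_basis rec xe0 nondeg.
by exists B; rewrite -Ax.
Unshelve. all: by end_near. Qed.

Lemma LP_optimal_corner m n (A : 'M[R]_(m, n)) b d x :
  \rank A = m -> IP A b x -> optimal (LP A b) d x ->
  exists2 B, feasible_basis A b B & optimal (corner A b B) d x.
Proof.
move=> rA [Ax x0 xint] xopt.
have [B [fB dB]] := LP_optimal_basis rA xopt.
exists B => //; split; first by split=> // j _; exact: (nonnegP _ x0).
move=> z [Az z0 _]; case/andP: fB => uB fB.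
set xB := invmx _ *m b in fB.
pose y := (rowsub (basis_col B) d)^T *m invmx (basis_mx A B).
have yB i : (y *m A) 0 (basis_col B i) = d (basis_col B i) 0.
  have : colsub (basis_col B) (y *m A) = (rowsub (basis_col B) d)^T.
    by rewrite -mulmx_colsub mulmxKV.
  by move/(congr1 (fun v : 'rV_ _ => v 0 i)); rewrite !mxE.
(* The basic solution of [B] is LP-feasible, so it costs at least [dot d x]. *)
have xBopt : dot d x <= dot d (pad (basis_col B) xB).
  apply: xopt.2; split; first by rewrite mul_pad mulKVmx.
  apply/nonnegP => j; have [/basis_colP[i ->]|jB] := boolP (j \in val B).
    by rewrite pad_in ?(nonnegP _ fB)//; exact: basis_col_inj.
  by rewrite pad_out//; exact: basis_colPn.
apply: le_trans xBopt _.
have -> : dot d (pad (basis_col B) xB) = (y *m A *m z) 0 0.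
  by rewrite dot_pad /dot /xB mulmxA -[in RHS]mulmxA Az.
rewrite dotE mxE; apply: ler_sum => j _.
have [/basis_colP[i ->]|jB] := boolP (j \in val B); first by rewrite yB.
by rewrite ler_wpM2r ?z0//; exact: dB.
Qed.

End Perturbation.

(** * Attainment in the inverse problems *)

Section Attainment.
Variable R : realType.

Lemma continuous_normr_powR (q : R) :
  0 < q -> continuous (fun t : R => `|t| `^ q).
Proof.
move=> q0 t; have [->|t0] := eqVneq t 0.
  suff : (fun s : R => `|s| `^ q) s @[s --> (0 : R)] --> (0 : R).
    by rewrite /continuous_at normr0 powR0 ?gt_eqF.
  apply/(@cvgr0Pnorm_lt _ _ _ (nbhs (0 : R))) => e e0.
  have e1 : 0 < e `^ q^-1 by rewrite powR_gt0.
  have eE : e = (e `^ q^-1) `^ q.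
    by rewrite -powRrM mulVf ?gt_eqF// powRr1// ltW.
  near=> s; have s1 : `|s| < e `^ q^-1 by near: s; exact: (@nbhs0_lt _ R^o).
  rewrite ger0_norm ?powR_ge0// eE.
  by rewrite gt0_ltr_powR ?nnegrE ?powR_ge0.
have a0 : 0 < `|t| by rewrite normr_gt0.
apply: (@continuous_comp R R R (fun s : R => `|s|) (fun s => s `^ q)).
  exact: (@norm_continuous _ R^o).
apply/differentiable_continuous/derivable1_diffP/derivable_powR.
by rewrite in_itv/= andbT.
Unshelve. all: by end_near. Qed.

Lemma continuous_bigmax0 (T : topologicalType) n (F : 'I_n -> T -> R) :
  (forall j, continuous (F j)) ->
  continuous (fun v => \big[Num.max/0]_j F j v).
Proof.
move=> Fc; elim: (index_enum _) => [|j r IH].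
  by under eq_fun do rewrite big_nil; exact: cst_continuous.
under eq_fun do rewrite big_cons; move=> v.
exact: (continuous_max (Fc j v) (IH v)).
Qed.

Lemma continuous_bigsum (T : topologicalType) n (F : 'I_n -> T -> R) :
  (forall j, continuous (F j)) -> continuous (fun v => \sum_j F j v).
Proof.
move=> Fc; elim: (index_enum _) => [|j r IH].
  by under eq_fun do rewrite big_nil; exact: cst_continuous.
under eq_fun do rewrite big_cons; move=> v.
exact: (cvgD (Fc j v) (IH v)).
Qed.

Variables (n : nat) (p : \bar R) (w : 'cV[R]_n).
Hypotheses (p_ge1 : (1 <= p)%E) (w_gt0 : forall j, 0 < w j 0).

Lemma wLp_continuous (T : topologicalType) (F : 'I_n -> T -> R) :
  (forall j, continuous (F j)) -> continuous (fun v => wLp p w (\col_j F j v)).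
Proof.
move=> Fc.
have wFc j : continuous (fun v => w j 0 * `|F j v|).
  move=> v; apply: cvgM; first exact: cvg_cst.
  exact: (cvg_norm (Fc j v)).
case: p p_ge1 => [q|_|//] /=; last first.
  under eq_fun do under eq_bigr do rewrite mxE.
  exact: continuous_bigmax0.
rewrite lee_fin => q1; have q0 : 0 < q by exact: lt_le_trans q1.
pose S v := \sum_j `|w j 0 * `|F j v| | `^ q.
have -> : (fun v => (\sum_j (w j 0 * `|(\col_j F j v) j 0|) `^ q) `^ q^-1)
   = (fun t => `|t| `^ q^-1) \o S.
  apply/funext => v /=; rewrite ger0_norm; last first.
    by apply: sumr_ge0 => j _; exact: powR_ge0.
  congr (_ `^ _); apply: eq_bigr => j _.
  by rewrite mxE normrM normr_id (gtr0_norm (w_gt0 j)).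
have Sc : continuous S.
  apply: continuous_bigsum => j v.
  apply: (@continuous_comp _ _ _
    (fun v => w j 0 * `|F j v|) (fun t => `|t| `^ q)).
    exact: wFc.
  exact: continuous_normr_powR.
move=> v; apply: continuous_comp; first exact: Sc.
by apply: continuous_normr_powR; rewrite invr_gt0.
Qed.

Lemma wLp_ge_coord (v : 'cV[R]_n) j : w j 0 * `|v j 0| <= wLp p w v.
Proof.
case: p p_ge1 => [q|_|//] /=; last exact: le_bigmax.
rewrite lee_fin => q1; have q0 : 0 < q by exact: lt_le_trans q1.
have wv0 k : 0 <= w k 0 * `|v k 0| by rewrite mulr_ge0// ltW.
rewrite -[leLHS]powRr1// -(mulfV (lt0r_neq0 q0)) powRrM.
apply: ge0_ler_powR.
- by rewrite invr_ge0 ltW.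
- by rewrite nnegrE powR_ge0.
- by rewrite nnegrE sumr_ge0// => k _; exact: powR_ge0.
by rewrite (bigD1 j)//= lerDl sumr_ge0// => k _; exact: powR_ge0.
Qed.

(** Every nonempty feasible region is allowed: the objective [0] always lies in
    the inverse-feasible region, and its distance to [c] bounds the search. *)
Lemma inv_value_attained (c : 'cV[R]_n) (P : set 'cV[R]_n) (x : 'cV[R]_n) :
  P x -> inv_values p w c P x (zInv p w c P x).
Proof.
move=> Px; pose f (v : 'rV[R]_n) := wLp p w (v^T - c).
have fc : continuous f.
  have -> : f = fun v => wLp p w (\col_j (v 0 j - c j 0)).
    apply/funext => v; congr (wLp p w _).
    by apply/matrixP => i j; rewrite !mxE ord1.
  apply: wLp_continuous => j v.
  apply: (@cvgB R R^o _ (nbhs v) _ (fun v : 'rV[R]_n => v 0 j) (fun=> c j 0)).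
    exact: (@coord_continuous R 1 n 0 j).
  exact: cvg_cst.
(* The inverse-feasible region, as an intersection of closed half-spaces of
   row vectors. *)
pose H := [set v : 'rV[R]_n | forall y, P y -> 0 <= \sum_j v 0 j * (y - x) j 0].
have HE v : H v <-> IFR P x v^T.
  have e y : \sum_j v 0 j * (y - x) j 0 = dot v^T y - dot v^T x.
    by rewrite -dotNr -dotDr dotE; apply: eq_bigr => j _; rewrite [v^T _ _]mxE.
  split=> [Hv|[_ Hv]].
    by split=> // y Py; rewrite -subr_ge0 -e; exact: Hv.
  by move=> y Py; rewrite e subr_ge0; exact: Hv.
have Hclosed : closed H.
  have -> : H = \bigcap_(y in P)
    [set v : 'rV[R]_n | 0 <= \sum_j v 0 j * (y - x) j 0].
    by apply/seteqP; split => v /= Hv y Py; exact: Hv.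
  apply: closed_bigI => y _.
  apply: (@closed_comp _ _
    (fun v : 'rV[R]_n => \sum_j v 0 j * (y - x) j 0) [set t : R | 0 <= t]).
    move=> v _; apply: continuous_bigsum => j u.
    apply: (@cvgM R _ (nbhs u) _ (fun v : 'rV[R]_n => v 0 j)
      (fun=> (y - x) j 0)).
      exact: (@coord_continuous R 1 n 0 j).
    exact: cvg_cst.
  exact: closed_ge.
pose M := f 0.
(* A box containing all the vectors no farther from [c] than [0]. *)
pose D := [set v : 'rV[R]_n | forall j,
  `[c j 0 - M / w j 0, c j 0 + M / w j 0]%classic (v 0 j)].
have DE v : f v <= M -> D v.
  move=> fv j; rewrite /= in_itv/= -ler_distl ler_pdivlMr// mulrC.
  by have := wLp_ge_coord (v^T - c) j; rewrite !mxE => /le_trans; apply.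
have [||v vK vmin] :=
  @compact_EVT_min _ _ f (D `&` H) _ _ (continuous_subspaceT fc).
- exists 0; split; first exact: DE.
  by move=> y _; rewrite big1// => j _; rewrite mxE mul0r.
- apply: compact_closedI Hclosed.
  by apply: (@rV_compact R n (fun j => _)) => j; exact: segment_compact.
move: vK; rewrite inE => -[Dv Hv].
have vopt d : IFR P x d -> f v <= wLp p w (d - c).
  move=> dI; have -> : d = (d^T)^T by rewrite trmxK.
  rewrite -/(f d^T); have [/DE dD|/ltW Md] := leP (f d^T) M.
    by apply: vmin; rewrite inE; split=> //; apply/HE; rewrite trmxK.
  apply: le_trans Md; apply: vmin; rewrite inE; split; first exact: DE.
  by move=> y _; rewrite big1// => j _; rewrite mxE mul0r.
suff -> : zInv p w c P x = (f v)%:E by exists v^T => //; exact/HE.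
apply/eqP; rewrite eq_le; apply/andP; split.
  by apply: ereal_inf_lbound; exists v^T => //; exact/HE.
by apply: le_ereal_inf_tmp => _ [d /vopt vd <-]; rewrite lee_fin.
Qed.

End Attainment.

(** * Comparison of the regions and of the optimal values *)

Lemma IFR_sub (R : realType) n (P Q : set 'cV[R]_n) x :
  Q x -> Q `<=` P -> IFR P x `<=` IFR Q x.
Proof. by move=> Qx QP d [_ dP]; split=> // y /QP; exact: dP. Qed.

Lemma zInv_le (R : realType) n p (w c : 'cV[R]_n) (P Q : set 'cV[R]_n) x :
  IFR P x `<=` IFR Q x -> (zInv p w c Q x <= zInv p w c P x)%E.
Proof. by move=> PQ; apply: ereal_inf_le_tmp => _ [d /PQ dQ <-]; exists d. Qed.

Lemma IP_sub_corner (R : realType) m n (A : 'M[R]_(m, n)) b B :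
  IP A b `<=` corner A b B.
Proof. by move=> y [Ay /nonnegP y0 yint]; split. Qed.

Theorem corollary1 (R : realType) (m n : nat) (A : 'M[R]_(m, n))
  (b : 'cV[R]_m) (c : 'cV[R]_n) (p : \bar R) (w : 'cV[R]_n) (x0 : 'cV[R]_n)
  (le_mn : (m <= n)%N)
  (A_int : A \is a mxOver Num.int)
  (b_int : b \is a mxOver Num.int)
  (A_full : \rank A = m)
  (p_ge1 : (1 <= p)%E)
  (w_gt0 : forall j, 0 < w j 0)
  (x0_feas : IP A b x0) :
  (forall B, feasible_basis A b B ->
     optimal (corner A b B) c x0 -> optimal (IP A b) c x0)
  /\
  (IFR (LP A b) x0 `<=`
     \bigcup_(B in [set B | feasible_basis A b B]) IFR (corner A b B) x0
   /\
   \bigcup_(B in [set B | feasible_basis A b B]) IFR (corner A b B) x0 `<=`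
     IFR (IP A b) x0)
  /\
  (* the minima defining the optimal values are attained *)
  [/\ inv_values p w c (LP A b) x0 (zInv p w c (LP A b) x0),
      forall B, feasible_basis A b B ->
        inv_values p w c (corner A b B) x0 (zInv p w c (corner A b B) x0)
    & inv_values p w c (IP A b) x0 (zInv p w c (IP A b) x0)]
  /\
  ((\big[mine/+oo]_(B | feasible_basis A b B) zInv p w c (corner A b B) x0
      <= zInv p w c (LP A b) x0)%E
   /\
   (zInv p w c (IP A b) x0
      <= \big[mine/+oo]_(B | feasible_basis A b B)
           zInv p w c (corner A b B) x0)%E).
Proof.
have corner_IP B : IFR (corner A b B) x0 `<=` IFR (IP A b) x0.
  exact/IFR_sub/IP_sub_corner.
have x0_LP : LP A b x0 by case: x0_feas.
split; first by move=> B _; exact: corner_IP.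
split; first split.
- by move=> d /(LP_optimal_corner A_full x0_feas)[B fB dB]; exists B.
- by move=> d [B _]; exact: corner_IP.
split; first split.
- exact: inv_value_attained.
- by move=> B _; apply: inv_value_attained => //; exact: IP_sub_corner.
- exact: inv_value_attained.
split; last by apply: le_bigmin => [|B _]; [exact: leey|exact: zInv_le].
have [d dLP <-] := inv_value_attained p_ge1 w_gt0 c x0_LP.
have [B fB dB] := LP_optimal_corner A_full x0_feas dLP.
apply: le_trans (bigmin_le_cond _ _ fB) _; apply: ereal_inf_lbound.
by exists d.
Qed.
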